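(* Let $k$ be a commutative field, let $H = k1_H\oplus H'$ be a connected bialgebra over $k$ (with $H'=\ker\eta$), and let $H'^{\mathrm{st}}$ be the stuffle Hopf algebra of the (non-unital) associative algebra $H'$. Then the map $\iota : H\to H'^{\mathrm{st}}$ defined as the linear map with $\iota(1_H)=\emptyset$ and $$\iota(h)=\sum_{n\ge 1}\Delta'^{[n]}(h)\in (H'^{\mathrm{st}})'\qquad (h\in H')$$ (where $\Delta'^{[n]}(h)\in H'^{\otimes n}$ is regarded as an element of the length-$n$ component of $H'^{\mathrm{st}}$) defines an injective Hopf morphism, i.e. an injective morphism of unital algebras and of counital coalgebras between the Hopf algebras $H$ and $H'^{\mathrm{st}}$.
   Context: All vector spaces, algebras and tensor products are over a commutative field $k$; algebras are associative. Connected bialgebras. A bialgebra $(H,m,u,\Delta,\eta)$ is filtered if there are subspaces $H_0\subsetneq H_1\subsetneq\cdots$ with $\bigcup_{n\ge0}H_n=H$, $\Delta H_n\subseteq\sum_{i=0}^n H_i\otimes H_{n-i}$ and $H_nH_m\subseteq H_{n+m}$. It is connected if moreover $H_0=k1_H$. A connected bialgebra is automatically a Hopf algebra. Put $H'=\ker\eta$, so $H=k1_H\oplus H'$, and let $p'=\mathrm{Id}-u\circ\eta$ be the projection onto $H'$. Define $\Delta^{[1]}=\mathrm{Id}$, $\Delta^{[n+1]}=(\mathrm{Id}\otimes\Delta^{[n]})\circ\Delta : H\to H^{\otimes (n+1)}$, and $\Delta'^{[n]}=p'^{\otimes n}\circ\Delta^{[n]}:H'\to H'^{\otimes n}$ for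 $n\ge1$ (so $\Delta'^{[1]}=\mathrm{Id}_{H'}$ and $\Delta'^{[2]}(h)=\Delta'(h)=\Delta h-1\otimes h-h\otimes1$). If $h\in H'\cap H_N$ with $N\ge 1$, then $\Delta'^{[n]}(h)=0$ for $n>N$, so sums $\sum_{n\ge1}\Delta'^{[n]}(h)$ are finite. Stuffle Hopf algebra. For an associative algebra $A$ (not necessarily unital), $A^{\mathrm{st}}=\bigoplus_{n\ge0}A^{\mathrm{st}}_{(n)}$ with $A^{\mathrm{st}}_{(0)}=k\emptyset$ and $A^{\mathrm{st}}_{(n)}=A^{\otimes n}$ for $n\ge1$; $(A^{\mathrm{st}})'=\bigoplus_{n\ge1}A^{\mathrm{st}}_{(n)}$. The symbol $\otimes$ between letters is the internal (concatenation) tensor product, and $\otimes_{\mathrm{st}}$ denotes the tensor product of elements of $A^{\mathrm{st}}$. The product $m_{\mathrm{st}}$ (stuffle, or quasi-shuffle) has unit $\emptyset$ and is defined recursively, for $\mathbf a=a_1\otimes\cdots\otimes a_r$, $\mathbf b=b_1\otimes\cdots\otimes b_s$ ($r,s\ge1$), $\tilde{\mathbf a}=a_1\otimes\cdots\otimes a_{r-1}$ ($=\emptyset$ if $r=1$), $\tilde{\mathbf b}=b_1\otimes\cdots\otimes b_{s-1}$ ($=\emptyset$ if $s=1$), by $$m_{\mathrm{st}}(\mathbf a\otimes_{\mathrm{st}}\mathbf b)=m_{\mathrm{st}}(\tilde{\mathbf a}\otimes_{\mathrm{st}}\mathbf b)\otimes a_r+m_{\mathrm{st}}(\mathbf a\otimes_{\mathrm{st}}\tilde{\mathbf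 b})\otimes b_s+m_{\mathrm{st}}(\tilde{\mathbf a}\otimes_{\mathrm{st}}\tilde{\mathbf b})\otimes a_rb_s.$$ The counit is $\eta_{\mathrm{st}}(\emptyset)=1$, $\eta_{\mathrm{st}}=0$ on $(A^{\mathrm{st}})'$. The coproduct is deconcatenation: $\Delta_{\mathrm{st}}(\emptyset)=\emptyset\otimes_{\mathrm{st}}\emptyset$ and $\Delta_{\mathrm{st}}(a_1\otimes\cdots\otimes a_s)=\mathbf a\otimes_{\mathrm{st}}\emptyset+\emptyset\otimes_{\mathrm{st}}\mathbf a+\sum_{r=1}^{s-1}(a_1\otimes\cdots\otimes a_r)\otimes_{\mathrm{st}}(a_{r+1}\otimes\cdots\otimes a_s)$. With these, $A^{\mathrm{st}}$ is a connected bialgebra (filtered by length), hence a Hopf algebra. *)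

(* Defs.v *)
From HB Require Import structures.
From mathcomp Require Import all_boot all_algebra.
From mathcomp Require Import boolp.
From mathcomp.multinomials Require Import freeg.

Set Implicit Arguments.
Unset Strict Implicit.
Unset Printing Implicit Defensive.

Import GRing.Theory.
Local Open Scope ring_scope.
Local Open Scope quotient_scope.

Section Span.
Variables (k : fieldType) (U : lmodType k).

Inductive lin_span (S : U -> Prop) : U -> Prop :=
| LinSpan0 : lin_span S 0
| LinSpanD a x y : S x -> lin_span S y -> lin_span S (a *: x + y).

Lemma lin_spanD S x y : lin_span S x -> lin_span S y -> lin_span S (x + y).
Proof.
by elim=> [|a u v Su _ IH] Sy; rewrite ?add0r // -addrA; constructor => //; apply: IH.
Qed.

Lemma lin_spanZ S a x : lin_span S x -> lin_span S (a *: x).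
Proof.
elim=> [|b u v Su _ IH]; first by rewrite scaler0; constructor.
by rewrite scalerDr scalerA; constructor.
Qed.

Lemma lin_span_gen (S : U -> Prop) x : S x -> lin_span S x.
Proof. by move=> Sx; rewrite -[x]addr0 -[x]scale1r; constructor => //; constructor. Qed.

Definition span_pred (S : U -> Prop) : {pred U} := fun x => `[< lin_span S x >].

Lemma span_predP S x : reflect (lin_span S x) (x \in span_pred S).
Proof. exact: asboolP. Qed.

Lemma span_submod S : submod_closed (span_pred S).
Proof.
split; first by apply/span_predP; constructor.
by move=> a x y /span_predP Sx /span_predP Sy; apply/span_predP/lin_spanD => //; exact: lin_spanZ.
Qed.

HB.instance Definition _ S :=
  GRing.isSubmodClosed.Build k U (span_pred S) (span_submod S).

Variable S : U -> Prop.

Definition vquot := Quotient.quot (span_pred S).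
HB.instance Definition _ := GRing.Zmodule.on vquot.

Definition vproj (x : U) : vquot := \pi x.
Definition vrepr (x : vquot) : U := repr x.

Lemma vreprK : cancel vrepr vproj.
Proof. exact: reprK. Qed.

Lemma vproj_eqP x y : reflect (vproj x = vproj y) (x - y \in span_pred S).
Proof. by rewrite Quotient.idealrBE; exact: eqP. Qed.

Lemma vprojD : {morph vproj : x y / x + y}.
Proof. by move=> x y; rewrite /vproj piE. Qed.

Definition vscale a (x : vquot) : vquot := vproj (a *: vrepr x).

Lemma vscale_pi a x : vscale a (vproj x) = vproj (a *: x).
Proof.
apply/vproj_eqP; rewrite -scalerBr rpredZ //.
by apply/vproj_eqP; rewrite vreprK.
Qed.

Lemma vscaleA a b x : vscale a (vscale b x) = vscale (a * b) x.
Proof. by rewrite -[x]vreprK !vscale_pi scalerA. Qed.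
Lemma vscale1 : left_id 1 vscale.
Proof. by move=> x; rewrite -[x]vreprK !vscale_pi scale1r. Qed.
Lemma vscaleDr : right_distributive vscale +%R.
Proof.
by move=> a x y; rewrite -[x]vreprK -[y]vreprK !(vscale_pi, =^~vprojD) scalerDr.
Qed.
Lemma vscaleDl x : {morph vscale^~ x : a b / a + b}.
Proof. by move=> a b; rewrite -[x]vreprK !(vscale_pi, =^~vprojD) scalerDl. Qed.

HB.instance Definition _ :=
  GRing.Zmodule_isLmodule.Build k vquot vscaleA vscale1 vscaleDr vscaleDl.

Lemma vproj_linear : linear vproj.
Proof. by move=> a x y; rewrite vprojD -vscale_pi. Qed.

End Span.

Notation is_bilinear f := (bilinear_for *:%R *:%R f).

Section LinearFun.
Variables (k : fieldType) (U V : lmodType k) (f : U -> V).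
Hypothesis fl : linear f.

Lemma lin0 : f 0 = 0.
Proof. by rewrite -[in LHS](addNr 0) -scaleN1r fl scaleN1r addNr. Qed.
Lemma linD x y : f (x + y) = f x + f y.
Proof. by rewrite -[x]scale1r fl !scale1r. Qed.
Lemma linZ a x : f (a *: x) = a *: f x.
Proof. by rewrite -[a *: x]addr0 fl lin0 addr0. Qed.
Lemma linB x y : f (x - y) = f x - f y.
Proof. by rewrite linD -scaleN1r linZ scaleN1r. Qed.
Lemma lin_sum (I : Type) (r : seq I) (P : pred I) (F : I -> U) :
  f (\sum_(i <- r | P i) F i) = \sum_(i <- r | P i) f (F i).
Proof. exact: (big_morph f linD lin0). Qed.

End LinearFun.

Section Tensor.
Variables (k : fieldType) (U V : lmodType k).

Definition tens_free (u : U) (v : V) : {freeg (U * V) / k} :=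
  Freeg [:: (1, (u, v))].

Definition tens_rel (x : {freeg (U * V) / k}) : Prop :=
  (exists a u u' v,
     x = tens_free (a *: u + u') v - (a *: tens_free u v + tens_free u' v)) \/
  (exists a u v v',
     x = tens_free u (a *: v + v') - (a *: tens_free u v + tens_free u v')).

Definition tensor := vquot tens_rel.
HB.instance Definition _ := GRing.Lmodule.on tensor.

Definition tens (u : U) (v : V) : tensor := vproj tens_rel (tens_free u v).

Lemma tens_bilinear : is_bilinear tens.
Proof.
split=> [v a u u'|u a v v']; rewrite /= /tens -vproj_linear;
  apply/vproj_eqP/span_predP/lin_span_gen.
- by left; exists a, u, u', v.
- by right; exists a, u, v, v'.
Qed.

Lemma freeg_tensE (D : {freeg (U * V) / k}) :
  D = \sum_(p <- dom D) coeff p D *: tens_free p.1 p.2.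
Proof.
rewrite -{1}[D]freeg_sumE; apply: eq_bigr => -[u v] _.
apply/eqP/freeg_eqP => q.
by rewrite coeffZ !coeffU mul1r.
Qed.

Lemma tensE (t : tensor) : exists s : seq (k * (U * V)),
  t = \sum_(p <- s) p.1 *: tens p.2.1 p.2.2.
Proof.
rewrite -[t]vreprK; set D := vrepr t.
exists [seq (coeff p D, p) | p <- dom D]; rewrite big_map /=.
rewrite {1}[D]freeg_tensE.
rewrite (lin_sum (@vproj_linear _ _ _)); apply: eq_bigr => p _.
exact: (linZ (@vproj_linear _ _ _)).
Qed.

Lemma tensor_ind (P : tensor -> Prop) :
  P 0 -> (forall a u v t, P t -> P (a *: tens u v + t)) -> forall t, P t.
Proof.
move=> P0 PD t; have [s ->] := tensE t.
by elim: s => [|p s IH]; rewrite ?big_nil ?big_cons //; apply: PD.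
Qed.

(* Total in [f] so that it can be used before bilinearity of [f] is known;
   only meaningful for bilinear [f], see [tlift_tens]. *)
Definition tlift (W : lmodType k) (f : U -> V -> W) (t : tensor) : W :=
  fglift (fun p : U * V => f p.1 p.2) (vrepr t).

Section Lift.
Variables (W : lmodType k) (f : U -> V -> W).

Lemma fglift_linear : linear (fglift (fun p : U * V => f p.1 p.2)).
Proof.
set g := fun p => _; have addg := lift_is_additive g.
have gD x y : fglift g (x + y) = fglift g x + fglift g y.
  have g0 : fglift g 0 = 0 by rewrite -[0](subrr 0) addg subrr.
  have gN z : fglift g (- z) = - fglift g z by rewrite -[- z]add0r addg g0 add0r.
  by rewrite -{1}[y]opprK addg gN opprK.
move=> a x y; rewrite gD; congr (_ + _); elim/freeg_ind_dom0: x => [|b p D _ _ IH].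
  by rewrite scaler0 -[0](subrr 0) addg subrr scaler0.
rewrite scalerDr !gD IH scalerDr; congr (_ + _).
have -> : a *: Freeg [:: (b, p)] = Freeg [:: (a * b, p)].
  by apply/eqP/freeg_eqP => q; rewrite coeffZ !coeffU mulrA.
by rewrite !liftU scalerA.
Qed.

Hypothesis fbil : is_bilinear f.

Lemma fglift_span x :
  x \in span_pred tens_rel -> fglift (fun p : U * V => f p.1 p.2) x = 0.
Proof.
set g := fglift _; have gl : linear g := fglift_linear.
have g0 := lin0 gl; have gB := linB gl.
have gt u v : g (tens_free u v) = f u v by rewrite /g liftU scale1r.
move/span_predP; elim=> [//|a u v Su _ IH]; rewrite gl IH addr0.
have [f1 f2] := fbil.
case: Su => -[b [c [d [e ->]]]]; rewrite gB gl !gt.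
- by rewrite (f1 e b c d) subrr scaler0.
- by rewrite (f2 c b d e) subrr scaler0.
Qed.

Lemma tlift_proj x :
  tlift f (vproj tens_rel x) = fglift (fun p : U * V => f p.1 p.2) x.
Proof.
apply/eqP; rewrite -subr_eq0; apply/eqP.
have gl := fglift_linear.
rewrite -(linB gl); apply: fglift_span.
by apply/vproj_eqP; rewrite vreprK.
Qed.

Lemma tlift_tens u v : tlift f (tens u v) = f u v.
Proof. by rewrite tlift_proj liftU scale1r. Qed.

Lemma tlift_linear : linear (tlift f).
Proof.
move=> a x y; rewrite -[x]vreprK -[y]vreprK -vproj_linear !tlift_proj.
exact: fglift_linear.
Qed.

Lemma tlift_unique (g : {linear tensor -> W}) :
  (forall u v, g (tens u v) = f u v) -> g =1 tlift f.
Proof.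
move=> gE; elim/tensor_ind => [|a u v t IH].
  by rewrite linear0 (lin0 tlift_linear).
by rewrite linearP tlift_linear gE tlift_tens IH.
Qed.

End Lift.
End Tensor.

Infix "⊗" := (@tens _ _ _) (at level 40, left associativity) : ring_scope.

Section TensorMaps.
Variable k : fieldType.

Definition tmap (U V U' V' : lmodType k) (f : U -> U') (g : V -> V') :
    tensor U V -> tensor U' V' :=
  tlift (fun u v => f u ⊗ g v).

Definition tassoc (U V W : lmodType k) :
    tensor (tensor U V) W -> tensor U (tensor V W) :=
  tlift (fun t w => tlift (fun u v => u ⊗ (v ⊗ w)) t).

Definition tmul (A B : algType k) (x y : tensor A B) : tensor A B :=
  tlift (fun a b => tlift (fun c d => (a * c) ⊗ (b * d)) y) x.

Section Theory.
Variables (U V U' V' : lmodType k).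

Lemma comp_bilinear (W : lmodType k) (h : U' -> V' -> W) (f : U -> U') (g : V -> V') :
  is_bilinear h -> linear f -> linear g -> is_bilinear (fun u v => h (f u) (g v)).
Proof.
move=> [h1 h2] fl gl; split=> [v a u u'|u a v v'] /=.
- by rewrite fl; apply: h1.
- by rewrite gl; apply: h2.
Qed.

Lemma tmap_bilinear (f : U -> U') (g : V -> V') :
  linear f -> linear g -> is_bilinear (fun u v => f u ⊗ g v).
Proof. by move=> fl gl; apply: comp_bilinear => //; apply: tens_bilinear. Qed.

Lemma tmap_linear (f : U -> U') (g : V -> V') :
  linear f -> linear g -> linear (tmap f g).
Proof. by move=> fl gl; apply/tlift_linear/tmap_bilinear. Qed.

Lemma tmap_tens (f : U -> U') (g : V -> V') u v :
  linear f -> linear g -> tmap f g (u ⊗ v) = f u ⊗ g v.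
Proof. by move=> fl gl; rewrite /tmap tlift_tens //; apply: tmap_bilinear. Qed.

End Theory.

Lemma tlift_param (U V W X : lmodType k) (f : X -> U -> V -> W) :
  (forall x, is_bilinear (f x)) -> (forall u v, linear (fun x => f x u v)) ->
  forall t, linear (fun x => tlift (f x) t).
Proof.
move=> fb fl t a x y; elim/tensor_ind: t => [|b u v t IH].
  by rewrite !(lin0 (tlift_linear (fb _))) scaler0 addr0.
rewrite !(tlift_linear (fb _)) IH !(tlift_tens (fb _)) fl.
by rewrite !scalerDr !scalerA mulrC !addrA; congr (_ + _); rewrite -!addrA; congr (_ + _);
   rewrite addrC.
Qed.

Lemma tassoc_tens (U V W : lmodType k) (u : U) (v : V) (w : W) :
  tassoc (u ⊗ v ⊗ w) = u ⊗ (v ⊗ w).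
Proof.
have b1 (w0 : W) : is_bilinear (fun (u : U) (v : V) => u ⊗ (v ⊗ w0)).
  apply: (comp_bilinear (tens_bilinear _ _)) => // a x y.
  by have [h1 _] := tens_bilinear V W; apply: h1.
rewrite /tassoc tlift_tens ?tlift_tens //; split=> [w0|t] /=.
  exact: tlift_linear.
apply: (tlift_param (f := fun (w : W) (u : U) (v : V) => u ⊗ (v ⊗ w))) => // u0 v0 a x y.
have [_ h2] := tens_bilinear V W; have [_ h3] := tens_bilinear U (tensor V W).
by rewrite (h2 v0) (h3 u0).
Qed.

Lemma tmul_tens (A B : algType k) (a c : A) (b d : B) :
  tmul (a ⊗ b) (c ⊗ d) = (a * c) ⊗ (b * d).
Proof.
have b1 (a0 : A) (b0 : B) : is_bilinear (fun c d => (a0 * c) ⊗ (b0 * d)).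
  apply: (comp_bilinear (tens_bilinear _ _)) => e x y.
  - by rewrite mulrDr -scalerAr.
  - by rewrite mulrDr -scalerAr.
rewrite /tmul tlift_tens ?tlift_tens //; have [h1 h2] := tens_bilinear A B.
split=> [b0|a0] /=.
- apply: (tlift_param (f := fun a c d => (a * c) ⊗ (b0 * d))) => // u0 v0 e x y.
  by rewrite mulrDl -scalerAl (h1 (b0 * v0)).
- apply: (tlift_param (f := fun b c d => (a0 * c) ⊗ (b * d))) => // u0 v0 e x y.
  by rewrite mulrDl -scalerAl (h2 (a0 * u0)).
Qed.

End TensorMaps.

Section DirectSum.
Variables (k : fieldType) (T : nat -> lmodType k).

Record dsum := DSum {
  dfam :> forall n, T n;
  dfam_fin : exists N, forall n, (N <= n)%N -> dfam n = 0 }.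

Lemma dsum_eqP (x y : dsum) : (forall n, x n = y n) -> x = y.
Proof.
case: x y => [x Hx] [y Hy] /= xy; have e : x = y by apply: functional_extensionality_dep.
by case: y / e Hy {xy} => Hy; congr DSum; apply: Prop_irrelevance.
Qed.

HB.instance Definition _ := gen_eqMixin dsum.
HB.instance Definition _ := gen_choiceMixin dsum.

Lemma dsum0_fin : exists N, forall n, (N <= n)%N -> (0 : T n) = 0.
Proof. by exists 0. Qed.
Definition dsum0 := @DSum (fun n => 0) dsum0_fin.

Lemma dsum_opp_fin (x : dsum) : exists N, forall n, (N <= n)%N -> - x n = 0.
Proof. by have [N H] := dfam_fin x; exists N => n /H ->; rewrite oppr0. Qed.
Definition dsum_opp x := DSum (dsum_opp_fin x).

Lemma dsum_add_fin (x y : dsum) : exists N, forall n, (N <= n)%N -> x n + y n = 0.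
Proof.
have [N H] := dfam_fin x; have [M K] := dfam_fin y; exists (maxn N M) => n.
by rewrite geq_max => /andP[/H -> /K ->]; rewrite addr0.
Qed.
Definition dsum_add x y := DSum (dsum_add_fin x y).

Lemma dsum_scale_fin a (x : dsum) : exists N, forall n, (N <= n)%N -> a *: x n = 0.
Proof. by have [N H] := dfam_fin x; exists N => n /H ->; rewrite scaler0. Qed.
Definition dsum_scale a x := DSum (dsum_scale_fin a x).

Lemma dsum_addA : associative dsum_add.
Proof. by move=> x y z; apply: dsum_eqP => n; apply: addrA. Qed.
Lemma dsum_addC : commutative dsum_add.
Proof. by move=> x y; apply: dsum_eqP => n; apply: addrC. Qed.
Lemma dsum_add0 : left_id dsum0 dsum_add.
Proof. by move=> x; apply: dsum_eqP => n; apply: add0r. Qed.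
Lemma dsum_addN : left_inverse dsum0 dsum_opp dsum_add.
Proof. by move=> x; apply: dsum_eqP => n; apply: addNr. Qed.
HB.instance Definition _ :=
  GRing.isZmodule.Build dsum dsum_addA dsum_addC dsum_add0 dsum_addN.

Lemma dsum_scaleA a b x : dsum_scale a (dsum_scale b x) = dsum_scale (a * b) x.
Proof. by apply: dsum_eqP => n; apply: scalerA. Qed.
Lemma dsum_scale1 : left_id 1 dsum_scale.
Proof. by move=> x; apply: dsum_eqP => n; apply: scale1r. Qed.
Lemma dsum_scaleDr : right_distributive dsum_scale +%R.
Proof. by move=> a x y; apply: dsum_eqP => n; apply: scalerDr. Qed.
Lemma dsum_scaleDl x : {morph dsum_scale^~ x : a b / a + b}.
Proof. by move=> a b; apply: dsum_eqP => n; apply: scalerDl. Qed.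
HB.instance Definition _ :=
  GRing.Zmodule_isLmodule.Build k dsum dsum_scaleA dsum_scale1 dsum_scaleDr dsum_scaleDl.

Lemma dfam_linear n : linear (fun x : dsum => x n).
Proof. by []. Qed.

Lemma dfamP a (x y : dsum) n : (a *: x + y : dsum) n = a *: x n + y n.
Proof. by []. Qed.

Lemma dsum_inj_fin n (x : T n) :
  exists N, forall m, (N <= m)%N -> dfwith (fun m => 0 : T m) x m = 0.
Proof. by exists n.+1 => m ltnm; rewrite dfwith_out // ltn_eqF. Qed.
Definition dsum_inj n (x : T n) := DSum (dsum_inj_fin x).
Arguments dsum_inj : simpl never.

Lemma dsum_injE n (x : T n) : dsum_inj x n = x.
Proof. exact: dfwith_in. Qed.
Lemma dsum_injN n m (x : T n) : n != m -> dsum_inj x m = 0.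
Proof. by move=> nm; apply: dfwith_out. Qed.

Lemma dsum_inj_linear n : linear (@dsum_inj n).
Proof.
move=> a x y; apply: dsum_eqP => m; rewrite dfamP.
have [<-|nm] := eqVneq n m; first by rewrite !dsum_injE.
by rewrite !dsum_injN // scaler0 addr0.
Qed.

Definition dsum_bound (x : dsum) : nat := projT1 (cid (dfam_fin x)).

Lemma dsum_boundP (x : dsum) n : (dsum_bound x <= n)%N -> x n = 0.
Proof. exact: projT2 (cid (dfam_fin x)) n. Qed.

Lemma dsumE (x : dsum) : x = \sum_(n < dsum_bound x) dsum_inj (x n).
Proof.
apply: dsum_eqP => m; rewrite (lin_sum (@dfam_linear m)).
have [ltm|lem] := ltnP m (dsum_bound x); last first.
  rewrite dsum_boundP // big1 // => n _; rewrite dsum_injN // neq_ltn.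
  by rewrite (leq_trans _ lem).
rewrite (bigD1 (Ordinal ltm)) //.
rewrite [X in _ = X + _]dsum_injE big1 ?addr0 // => n nm.
by rewrite dsum_injN //; apply: contraNneq nm => /= nm; apply/eqP/val_inj.
Qed.

(* The linear map on the direct sum with restriction [f n] to the summand [n]. *)
Definition dsum_lift (W : lmodType k) (f : forall n, T n -> W) (x : dsum) : W :=
  \sum_(n < dsum_bound x) f n (x n).

Section DSumLift.
Variables (W : lmodType k) (f : forall n, T n -> W).
Hypothesis fl : forall n, linear (@f n).

Lemma dsum_liftE N (x : dsum) :
  (forall n, (N <= n)%N -> x n = 0) -> dsum_lift f x = \sum_(n < N) f (x n).
Proof.
move=> xN; set M := maxn N (dsum_bound x).
have big K : (forall n, (K <= n)%N -> x n = 0) -> (K <= M)%N ->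
    \sum_(n < K) f (x n) = \sum_(n < M) f (x n).
  move=> xK leKM; rewrite (big_ord_widen M (fun n => f (x n))) //.
  rewrite [RHS](bigID (fun n : 'I_M => (n < K)%N)) /= [X in _ + X]big1 ?addr0 //.
  by move=> n; rewrite -leqNgt => /xK ->; rewrite lin0.
rewrite /dsum_lift !big ?leq_maxl ?leq_maxr //; exact: dsum_boundP.
Qed.

Lemma dsum_lift_linear : linear (dsum_lift f).
Proof.
move=> a x y; pose N := maxn (dsum_bound x) (dsum_bound y).
have xN n : (N <= n)%N -> x n = 0.
  by rewrite geq_max => /andP[le _]; apply: dsum_boundP.
have yN n : (N <= n)%N -> y n = 0.
  by rewrite geq_max => /andP[_ le]; apply: dsum_boundP.
rewrite !(dsum_liftE (N := N)) //; last first.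
  by move=> n le; rewrite dfamP xN // yN // scaler0 addr0.
rewrite scaler_sumr -big_split; apply: eq_bigr => n _.
by rewrite dfamP fl.
Qed.

Lemma dsum_lift_inj n (x : T n) : dsum_lift f (dsum_inj x) = f x.
Proof.
rewrite (dsum_liftE (N := n.+1)); last first.
  by move=> m lt; rewrite dsum_injN // ltn_eqF.
rewrite big_ord_recr big1 => [|m _]; first by rewrite [LHS]add0r dsum_injE.
by rewrite dsum_injN ?lin0 // gtn_eqF /=.
Qed.

End DSumLift.
End DirectSum.

Section TensorPowers.
Variable k : fieldType.

(* The first power is [V] itself, and the others are nested to the right. *)
Fixpoint tpow (V : lmodType k) (n : nat) : lmodType k :=
  match n with
  | 0 => k^o
  | n'.+1 => match n' with 0 => V | _ => tensor V (tpow V n') end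
  end.

Fixpoint tpow_map (V W : lmodType k) (f : V -> W) n : tpow V n -> tpow W n :=
  match n return tpow V n -> tpow W n with
  | 0 => fun c : k^o => c
  | n'.+1 =>
    match n' return (tpow V n' -> tpow W n') -> tpow V n'.+1 -> tpow W n'.+1 with
    | 0 => fun _ => f
    | _.+1 => fun g => tmap f g
    end (@tpow_map V W f n')
  end.

(* The pure tensor of the first [n] letters of [s], for [n <= size s]. *)
Fixpoint tword (V : lmodType k) n (s : seq V) : tpow V n :=
  match n return tpow V n with
  | 0 => (1 : k^o)
  | n'.+1 =>
    match n' return (seq V -> tpow V n') -> tpow V n'.+1 with
    | 0 => fun _ => head 0 s
    | _.+1 => fun w => head 0 s ⊗ w (behead s)
    end (@tword V n')
  end.

Definition tens_alg (V : lmodType k) := dsum (tpow V).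
HB.instance Definition _ V := GRing.Lmodule.on (tens_alg V).

Definition word (V : lmodType k) (s : seq V) : tens_alg V :=
  dsum_inj (tword (size s) s).

(* The linear map on [tens_alg V] with a prescribed value on every pure tensor;
   only meaningful for multilinear [f], see [word_lift_word]. *)
Fixpoint tpow_lift (V W : lmodType k) n : (seq V -> W) -> tpow V n -> W :=
  match n return (seq V -> W) -> tpow V n -> W with
  | 0 => fun f (c : k^o) => c *: f [::]
  | n'.+1 =>
    match n' return
      ((seq V -> W) -> tpow V n' -> W) -> (seq V -> W) -> tpow V n'.+1 -> W with
    | 0 => fun _ f x => f [:: x]
    | _.+1 => fun g f => tlift (fun x t => g (fun s => f (x :: s)) t)
    end (@tpow_lift V W n')
  end.

Definition word_lift (V W : lmodType k) (f : seq V -> W) : tens_alg V -> W :=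
  dsum_lift (fun n => tpow_lift f (n := n)).

Definition multilinear (V W : lmodType k) (f : seq V -> W) :=
  forall s1 s2, linear (fun x => f (s1 ++ x :: s2)).

Section Theory.
Variables V W : lmodType k.
Implicit Types f : seq V -> W.

Lemma multilinear_cons f x : multilinear f -> multilinear (fun s => f (x :: s)).
Proof. by move=> fm s1 s2; apply: (fm (x :: s1)). Qed.

Lemma tpow_lift_param (X : lmodType k) n :
  (forall f, multilinear f -> linear (tpow_lift f (n := n))) /\
  forall F : X -> seq V -> W, (forall x, multilinear (F x)) ->
    (forall s, linear (fun x => F x s)) ->
    forall t : tpow V n, linear (fun x => tpow_lift (F x) t).
Proof.
suff H m (Y : lmodType k) : (forall f, multilinear f -> linear (tpow_lift f (n := m))) /\
  forall F : Y -> seq V -> W, (forall x, multilinear (F x)) ->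
    (forall s, linear (fun x => F x s)) ->
    forall t : tpow V m, linear (fun x => tpow_lift (F x) t) by exact: H.
elim: m Y => [|[|m] IH] Y.
- split=> [f _ a x y|F _ Fl t a x y] /=.
  + by rewrite scalerDl scalerA.
  + by rewrite Fl scalerDr !scalerA [a * _]mulrC.
- split=> [f fm|F _ Fl t] /=; [exact: (fm [::] [::])|exact: Fl].
have b f : multilinear f ->
    is_bilinear (fun x (t : tpow V m.+1) => tpow_lift (fun s => f (x :: s)) t).
  move=> fm; split=> [t|x] /=.
  - have [_ H] := IH V; apply: (H (fun x s => f (x :: s))) => [x|s].
      exact: multilinear_cons.
    exact: (fm [::] s).
  - by have [H _] := IH V; apply/H/multilinear_cons.
split=> [f fm|F Fm Fl t]; first exact/tlift_linear/b.
apply: (tlift_param (f := fun y x (t : tpow V m.+1) =>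
          tpow_lift (fun s => F y (x :: s)) t)) => [y|x t0]; first exact/b.
have [_ H] := IH Y.
by apply: (H (fun y s => F y (x :: s))) => [y|s]; [apply: multilinear_cons|apply: Fl].
Qed.

Lemma tpow_lift_linear n f : multilinear f -> linear (tpow_lift f (n := n)).
Proof. by have [H _] := tpow_lift_param V n; apply: H. Qed.

Lemma tpow_lift_tword n f s :
  multilinear f -> (n <= size s)%N -> tpow_lift f (tword n s) = f (take n s).
Proof.
elim: n f s => [|[|n] IH] f [|x s] fm //= les; rewrite ?take0 ?scale1r //.
rewrite tlift_tens; first exact: (IH (fun s0 => f (x :: s0)) s (multilinear_cons x fm) les).
split=> [t|y] /=.
- have [_ H] := tpow_lift_param V n.+1; apply: (H (fun x s => f (x :: s))) => [y|s0].
    exact: multilinear_cons.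
  exact: (fm [::] s0).
- exact: (tpow_lift_linear (n := n.+1) (multilinear_cons y fm)).
Qed.

Lemma word_lift_linear f : multilinear f -> linear (word_lift f).
Proof. by move=> fm; apply: dsum_lift_linear => n; apply: tpow_lift_linear. Qed.

Lemma word_lift_word f s : multilinear f -> word_lift f (word s) = f s.
Proof.
move=> fm; rewrite /word_lift dsum_lift_inj => [|n]; last exact: tpow_lift_linear.
by rewrite tpow_lift_tword // take_size.
Qed.

Lemma word_lift_param (X : lmodType k) (F : X -> seq V -> W) :
  (forall x, multilinear (F x)) -> (forall s, linear (fun x => F x s)) ->
  forall t, linear (fun x => word_lift (F x) t).
Proof.
move=> Fm Fl t a x y; rewrite /word_lift /dsum_lift scaler_sumr -big_split.
by apply: eq_bigr => n _; have [_ H] := tpow_lift_param X n; apply: (H F).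
Qed.

Lemma tword_multilinear n s1 s2 : (size s1 < n)%N ->
  linear (fun x : V => tword n (s1 ++ x :: s2)).
Proof.
elim: n s1 => [|[|n] IH] [|y s1] // lt a u v.
- by have [h _] := tens_bilinear V (tpow V n.+1); apply: (h (tword n.+1 s2)).
- have [_ h] := tens_bilinear V (tpow V n.+1).
  by rewrite [LHS]/(y ⊗ tword n.+1 _) IH //; apply: h.
Qed.

Lemma word_multilinear : multilinear (@word V).
Proof.
move=> s1 s2 a x y; rewrite /word !size_cat /=.
by rewrite tword_multilinear ?dsum_inj_linear // addnS ltnS leq_addr.
Qed.

Lemma tpow_spanE n (t : tpow V n) : exists r : seq (k * seq V),
  all (fun p => size p.2 == n) r /\ t = \sum_(p <- r) p.1 *: tword n p.2.
Proof.
elim: n t => [|[|n] IH] t.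
- by exists [:: (t, [::])]; rewrite big_seq1 /= [RHS]mulr1.
- by exists [:: (1, [:: t])]; rewrite big_seq1 /= scale1r.
elim/tensor_ind: t => [|a u v t [r [rn ->]]]; first by exists [::]; rewrite big_nil.
have [q [qn ->]] := IH v.
exists ([seq (a * p.1, u :: p.2) | p <- q] ++ r); split.
  by rewrite all_cat rn andbT all_map.
rewrite big_cat big_map /=; congr (_ + _).
have [_ h] := tens_bilinear V (tpow V n.+1).
rewrite (lin_sum (h u)) scaler_sumr; apply: eq_bigr => p _.
by rewrite (linZ (h u)) scalerA.
Qed.

Lemma word_ind (P : tens_alg V -> Prop) :
  P 0 -> (forall a s x, P x -> P (a *: word s + x)) -> forall x, P x.
Proof.
move=> P0 PD x; rewrite [x]dsumE.
have sumP n (F : 'I_n -> tens_alg V) :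
    (forall i, exists r : seq (k * seq V), F i = \sum_(p <- r) p.1 *: word p.2) ->
  P (\sum_(i < n) F i).
  elim: n F => [|n IH] F HF; first by rewrite big_ord0.
  rewrite big_ord_recl; have [r ->] := HF ord0.
  elim: r => [|p r IHr]; last by rewrite big_cons -addrA; apply: PD.
  by rewrite big_nil add0r; apply: IH.
apply: sumP => i; have [r [rn ->]] := tpow_spanE (x i); exists r.
rewrite (lin_sum (@dsum_inj_linear _ _ _)); apply: eq_big_seq => p /(allP rn) /eqP sp.
by rewrite (linZ (@dsum_inj_linear _ _ _)) /word sp.
Qed.

End Theory.
End TensorPowers.

(* Associative algebras without unit. *)
Record nuAlgebra (k : fieldType) := NUAlgebra {
  nu_sort :> lmodType k;
  nu_mul : nu_sort -> nu_sort -> nu_sort;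
  nu_mul_bilinear : is_bilinear nu_mul;
  nu_mulA : associative nu_mul }.

Section Stuffle.
Variables (k : fieldType) (A : nuAlgebra k).

Definition stuffle := tens_alg A.
HB.instance Definition _ := GRing.Lmodule.on stuffle.

(* [st_rcons x a] is the concatenation of [x] with the letter [a]. *)
Definition st_rcons (x : stuffle) (a : A) : stuffle :=
  word_lift (fun s => word (rcons s a)) x.

(* The arguments are reversed words: the recursion is on the last letters. *)
Fixpoint st_mul_rev (ra : seq A) : seq A -> stuffle :=
  match ra with
  | [::] => fun rb => word (rev rb)
  | a :: ra' =>
    fix mul_a (rb : seq A) : stuffle :=
      match rb with
      | [::] => word (rev ra)
      | b :: rb' => st_rcons (st_mul_rev ra' rb) a + st_rcons (mul_a rb') b
                    + st_rcons (st_mul_rev ra' rb') (nu_mul a b)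
      end
  end.

Definition st_mul (x y : stuffle) : stuffle :=
  word_lift (fun a => word_lift (fun b => st_mul_rev (rev a) (rev b)) y) x.

Definition st_one : stuffle := word [::].

Definition st_counit (x : stuffle) : k^o := x 0%N.

Definition st_coprod (x : stuffle) : tensor stuffle stuffle :=
  word_lift (fun s => \sum_(r < (size s).+1)
    (word (take r s) : stuffle) ⊗ (word (drop r s) : stuffle)) x.

Lemma word_rcons_multilinear (a : A) : multilinear (fun s => word (rcons s a)).
Proof.
move=> s1 s2 c x y; rewrite !rcons_cat /=.
exact: (@word_multilinear _ A s1 (rcons s2 a) c).
Qed.

Lemma st_rcons_bilinear : is_bilinear st_rcons.
Proof.
split=> [a|x] /=; first exact/word_lift_linear/word_rcons_multilinear.
apply: (word_lift_param (F := fun a s => word (rcons s a))) => [a|s].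
  exact: word_rcons_multilinear.
move=> c a b; rewrite -!cats1; exact: (@word_multilinear _ A s [::] c).
Qed.

Lemma st_rcons_word s a : st_rcons (word s) a = word (rcons s a).
Proof. exact/word_lift_word/word_rcons_multilinear. Qed.

Lemma word_rev_multilinear : multilinear (fun s : seq A => word (rev s)).
Proof.
move=> s1 s2 c x y; rewrite !rev_cat !rev_cons -!cats1 -!catA.
exact: (@word_multilinear _ A (rev s2) (rev s1) c).
Qed.

Lemma st_mul_rev0 ra : st_mul_rev ra [::] = word (rev ra).
Proof. by case: ra. Qed.

Lemma st_mul_rev_multilinear n :
  (forall rb s1 s2, (size rb + size s1 + size s2 < n)%N ->
     linear (fun x => st_mul_rev (s1 ++ x :: s2) rb)) /\
  (forall ra s1 s2, (size ra + size s1 + size s2 < n)%N ->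
     linear (fun x => st_mul_rev ra (s1 ++ x :: s2))).
Proof.
have r1 a (c : k) x y : st_rcons (c *: x + y) a = c *: st_rcons x a + st_rcons y a.
  exact: (st_rcons_bilinear.1 a c x y).
have r2 u (c : k) a b : st_rcons u (c *: a + b) = c *: st_rcons u a + st_rcons u b.
  exact: (st_rcons_bilinear.2 u c a b).
have m1 b (c : k) x y : nu_mul (c *: x + y) b = c *: nu_mul x b + nu_mul y b :> A.
  exact: ((nu_mul_bilinear A).1 b c x y).
have m2 b (c : k) x y : nu_mul b (c *: x + y) = c *: nu_mul b x + nu_mul b y :> A.
  exact: ((nu_mul_bilinear A).2 b c x y).
have sum3 (c : k) (x1 x2 x3 y1 y2 y3 : stuffle) :
    c *: x1 + y1 + (c *: x2 + y2) + (c *: x3 + y3)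
    = c *: (x1 + x2 + x3) + (y1 + y2 + y3).
  by rewrite (addrACA (c *: x1)) (addrACA (c *: x1 + c *: x2)) -!scalerDr.
elim: n => [|n [IHl IHr]]; first by split=> ? ? ?; rewrite ltn0.
split=> [[|b rb]|[|a ra]] s1 s2 lt c x y.
- by rewrite !st_mul_rev0; apply: word_rev_multilinear.
- case: s1 lt => [|a s1] lt.
  + rewrite [LHS]/(st_rcons (st_mul_rev s2 (b :: rb)) _
                   + st_rcons (st_mul_rev (_ :: s2) rb) b + st_rcons _ _).
    rewrite (r2 _ c x y) (m1 b c x y) (r2 _ c (nu_mul x b)).
    rewrite (IHl rb [::] s2 _ c x y); last by move: lt; rewrite /= !addSn.
    by rewrite !(r1 _ c); apply: sum3.
  + rewrite [LHS]/(st_rcons (st_mul_rev (s1 ++ _ :: s2) (b :: rb)) a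
        + st_rcons (st_mul_rev (a :: s1 ++ _ :: s2) rb) b
        + st_rcons (st_mul_rev (s1 ++ _ :: s2) rb) _).
    rewrite (IHl (b :: rb) s1 s2 _ c x y); last by move: lt; rewrite /= !addnS !addSn.
    rewrite (IHl rb (a :: s1) s2 _ c x y); last by move: lt; rewrite /= !addSn.
    rewrite (IHl rb s1 s2 _ c x y); last first.
      by move: lt; rewrite /= !addnS !addSn ltnS => /ltnW.
    by rewrite !(r1 _ c); apply: sum3.
- exact: word_rev_multilinear.
- case: s1 lt => [|b s1] lt.
  + rewrite [LHS]/(st_rcons (st_mul_rev ra (_ :: s2)) a
                   + st_rcons (st_mul_rev (a :: ra) s2) _ + st_rcons _ _).
    rewrite (r2 _ c x y) (m2 a c x y) (r2 _ c (nu_mul a x)).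
    rewrite (IHr ra [::] s2 _ c x y); last by move: lt; rewrite /= !addSn.
    by rewrite !(r1 _ c); apply: sum3.
  + rewrite [LHS]/(st_rcons (st_mul_rev ra (b :: s1 ++ _ :: s2)) a
        + st_rcons (st_mul_rev (a :: ra) (s1 ++ _ :: s2)) b
        + st_rcons (st_mul_rev ra (s1 ++ _ :: s2)) _).
    rewrite (IHr ra (b :: s1) s2 _ c x y); last by move: lt; rewrite /= !addSn.
    rewrite (IHr (a :: ra) s1 s2 _ c x y); last by move: lt; rewrite /= !addnS !addSn.
    rewrite (IHr ra s1 s2 _ c x y); last first.
      by move: lt; rewrite /= !addnS !addSn ltnS => /ltnW.
    by rewrite !(r1 _ c); apply: sum3.
Qed.

Lemma st_mul_rev_multil rb : multilinear (fun a => st_mul_rev (rev a) rb).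
Proof.
move=> s1 s2 c x y; rewrite !rev_cat !rev_cons -!cats1 -!catA.
by have [H _] := st_mul_rev_multilinear (size rb + size (rev s2) + size (rev s1)).+1; apply: H.
Qed.

Lemma st_mul_rev_multir ra : multilinear (fun b => st_mul_rev ra (rev b)).
Proof.
move=> s1 s2 c x y; rewrite !rev_cat !rev_cons -!cats1 -!catA.
by have [_ H] := st_mul_rev_multilinear (size ra + size (rev s2) + size (rev s1)).+1; apply: H.
Qed.

Lemma st_mul_multi y :
  multilinear (fun a => word_lift (fun b => st_mul_rev (rev a) (rev b)) y).
Proof.
move=> s1 s2.
apply: (word_lift_param (F := fun x b => st_mul_rev (rev (s1 ++ x :: s2)) (rev b))) => [x|b].
  exact: st_mul_rev_multir.
exact: st_mul_rev_multil.
Qed.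

Lemma st_mul_bilinear : is_bilinear st_mul.
Proof.
split=> [y|x] /=; first exact/word_lift_linear/st_mul_multi.
apply: (word_lift_param (F := fun y a =>
  word_lift (fun b => st_mul_rev (rev a) (rev b)) y)) => [y|a].
  exact: st_mul_multi.
exact/word_lift_linear/st_mul_rev_multir.
Qed.

Lemma st_mul_word (a b : seq A) : st_mul (word a) (word b) = st_mul_rev (rev a) (rev b).
Proof.
rewrite /st_mul word_lift_word; last exact: st_mul_multi.
exact/word_lift_word/st_mul_rev_multir.
Qed.

Lemma st_mul0w (b : seq A) : st_mul st_one (word b) = word b.
Proof. by rewrite st_mul_word /= revK. Qed.

Lemma st_mulw0 (a : seq A) : st_mul (word a) st_one = word a.
Proof. by rewrite st_mul_word st_mul_rev0 revK. Qed.

Lemma st_mul_rcons (a b : seq A) (x y : A) :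
  st_mul (word (rcons a x)) (word (rcons b y))
  = st_rcons (st_mul (word a) (word (rcons b y))) x
    + st_rcons (st_mul (word (rcons a x)) (word b)) y
    + st_rcons (st_mul (word a) (word b)) (nu_mul x y).
Proof. by rewrite !st_mul_word !rev_rcons. Qed.

Lemma st_coprod_multilinear : multilinear (fun s => \sum_(r < (size s).+1)
    (word (take r s) : stuffle) ⊗ (word (drop r s) : stuffle)).
Proof.
move=> s1 s2 c x y; rewrite !size_cat /= scaler_sumr -big_split; apply: eq_bigr => r _.
rewrite /= !take_cat !drop_cat; have [t1 t2] := tens_bilinear stuffle stuffle.
case: ltnP => [lt|le].
  rewrite (@word_multilinear _ A (drop r s1) s2 c x y); exact: t2.
case: (r - size s1)%N => [|m] /=.
  rewrite (@word_multilinear _ A [::] s2 c x y); exact: t2.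
rewrite (@word_multilinear _ A s1 (take m s2) c x y); exact: t1.
Qed.

Lemma st_coprod_linear : linear st_coprod.
Proof. exact/word_lift_linear/st_coprod_multilinear. Qed.

Lemma st_coprod_word (s : seq A) : st_coprod (word s) =
  \sum_(r < (size s).+1) (word (take r s) : stuffle) ⊗ (word (drop r s) : stuffle).
Proof. exact/word_lift_word/st_coprod_multilinear. Qed.

End Stuffle.

Record bialgebra (k : fieldType) := Bialgebra {
  bi_alg :> algType k;
  coprod : {linear bi_alg -> tensor bi_alg bi_alg};
  counit : {linear bi_alg -> k^o};
  coprodA : forall h : bi_alg,
    tassoc (tmap coprod idfun (coprod h)) = tmap idfun coprod (coprod h);
  counitl : forall h : bi_alg, tlift (fun x y : bi_alg => counit x *: y) (coprod h) = h;
  counitr : forall h : bi_alg, tlift (fun x y : bi_alg => counit y *: x) (coprod h) = h;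
  coprod1 : coprod 1 = 1 ⊗ 1;
  coprodM : forall x y : bi_alg, coprod (x * y) = tmul (coprod x) (coprod y);
  counit1 : counit 1 = 1;
  counitM : forall x y : bi_alg, counit (x * y) = counit x * counit y :> k }.

Arguments coprod {k b}.
Arguments counit {k b}.

Record connected_filtration (k : fieldType) (H : bialgebra k) (F : nat -> {pred H}) := {
  filt_submod : forall n, submod_closed (F n);
  filt_sub : forall n, {subset F n <= F n.+1};
  filt_neq : forall n, exists2 h, h \in F n.+1 & h \notin F n;
  filt_cover : forall h, exists n, h \in F n;
  filt_coprod : forall n h, h \in F n ->
    lin_span (fun t : tensor H H => exists i x y,
      [/\ (i <= n)%N, x \in F i, y \in F (n - i)%N & t = x ⊗ y]) (coprod h);
  filt_mul : forall n m x y, x \in F n -> y \in F m -> x * y \in F (n + m)%N;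
  filt_connected : forall h, h \in F 0%N <-> exists c : k, h = c%:A }.

Definition connected (k : fieldType) (H : bialgebra k) : Prop :=
  exists F, @connected_filtration k H F.

Section Augmentation.
Variables (k : fieldType) (H : bialgebra k).

Definition ker_counit : {pred H} := fun h => counit h == 0.

Lemma ker_counit_submod : submod_closed ker_counit.
Proof.
split=> [|a x y]; rewrite !unfold_in ?linear0 // => /eqP x0 /eqP y0.
by rewrite linearP x0 y0 scaler0 addr0.
Qed.

HB.instance Definition _ := GRing.isSubmodClosed.Build k H ker_counit ker_counit_submod.

Record aug_ideal := AugIdeal { aug_val :> H; aug_valP : aug_val \in ker_counit }.

HB.instance Definition _ := [isSub for aug_val].
HB.instance Definition _ := [Choice of aug_ideal by <:].
HB.instance Definition _ := [SubChoice_isSubLmodule of aug_ideal by <:].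

Lemma aug_val_linear : linear aug_val.
Proof. by move=> a x y; apply: (linearP (val : aug_ideal -> H)). Qed.

Lemma aug_mulP (x y : aug_ideal) : (x : H) * (y : H) \in ker_counit.
Proof.
rewrite unfold_in counitM; have /eqP -> := aug_valP x.
by rewrite mul0r.
Qed.

Definition aug_mul (x y : aug_ideal) := AugIdeal (aug_mulP x y).

Lemma aug_mul_bilinear : is_bilinear aug_mul.
Proof.
split=> [z a x y|z a x y]; apply: val_inj.
- apply: etrans (esym (aug_val_linear _ _ _)).
  by rewrite [LHS](congr1 ( *%R^~ (z : H)) (aug_val_linear a x y)) mulrDl -scalerAl.
- apply: etrans (esym (aug_val_linear _ _ _)).
  by rewrite [LHS](congr1 ( *%R (z : H)) (aug_val_linear a x y)) mulrDr -scalerAr.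
Qed.

Lemma aug_mulA : associative aug_mul.
Proof. by move=> x y z; apply: val_inj; rewrite /= mulrA. Qed.

Definition aug_alg := NUAlgebra aug_mul_bilinear aug_mulA.

Lemma aug_projP (h : H) : h - (counit h : k)%:A \in ker_counit.
Proof. by rewrite unfold_in linearB linearZ /= counit1 [_ *: _]mulr1 subrr. Qed.

Definition aug_proj (h : H) : aug_alg := AugIdeal (aug_projP h).

(* Indexed by the number of tensor factors; only n >= 1 is meaningful, the value
   at 0 is a filler. *)
Fixpoint iter_coprod n : H -> tpow H n :=
  match n return H -> tpow H n with
  | 0 => counit
  | n'.+1 =>
    match n' return (H -> tpow H n') -> H -> tpow H n'.+1 with
    | 0 => fun _ => idfun
    | _.+1 => fun D h => tmap idfun D (coprod h)
    end (iter_coprod n')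
  end.

Definition red_coprod n (h : aug_alg) : tpow aug_alg n :=
  tpow_map aug_proj (iter_coprod n (aug_val h)).

(* The sum over all n >= 1 is finite: [N] bounds the nonzero terms. *)
Definition is_stuffle_map (iota : H -> stuffle aug_alg) : Prop :=
  iota 1 = st_one aug_alg /\
  forall h : aug_alg, exists N,
    (forall n, (N < n)%N -> red_coprod n h = 0) /\
    iota (aug_val h) = \sum_(1 <= n < N.+1) dsum_inj (red_coprod n h).

End Augmentation.

(* Main.v *)
(** Put A = ker eta and p' = Id - u eta, and extend the definition to all of H by
    iota(h) = sum_(n >= 0) p'^(x n) Delta^[n](h), the term n = 0 being eta(h); this
    gives iota(1) = 1, and the components of length 0 and 1 of iota(h) are eta(h)
    and p'(h), hence injectivity.  By construction, in Sweedler notation,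
      iota(h) = eta(h) 1 + sum p'(h1).iota(h2)            (concatenation),
    so by coassociativity both Delta_st(iota(h)) and (iota (x) iota)(Delta h) are
    solutions E of
      E(h) = 1 (x) iota(h) + sum (p'(h1).- (x) Id)(E(h2)),
    and connectedness makes the solution unique.  As every x in the stuffle algebra
    is eta(x) 1 + sum x1.pi_1(x2), where pi_1 is the component of length 1, we get
      iota(h) = eta(h) 1 + sum iota(h1).p'(h2).
    Together with the recursive definition of the stuffle product and
      p'(xy) = p'(x) p'(y) + eta(x) p'(y) + eta(y) p'(x),
    this shows that D(x,y) = iota(xy) - iota(x) iota(y) satisfies
      D(x,y) = sum D(x1,y1).p'(x2)p'(y2) + sum D(x1,y).p'(x2) + sum D(x,y1).p'(y2),
    and connectedness again forces D = 0. *)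
Require Import Defs.
From HB Require Import structures.
From mathcomp Require Import all_boot all_algebra.
Import GRing.Theory.
Local Open Scope ring_scope.

Set Implicit Arguments.
Unset Strict Implicit.
Unset Printing Implicit Defensive.

#[local] Arguments dsum_inj : simpl never.

(** * Bilinear maps and tensor products *)

Section Bilinear.
Variables (k : fieldType) (U V W : lmodType k) (f : U -> V -> W).
Hypothesis fb : is_bilinear f.

Lemma bilinearl v : linear (fun u => f u v).
Proof. exact: fb.1. Qed.

Lemma bilinearr u : linear (f u).
Proof. exact: fb.2. Qed.

End Bilinear.

Section Tensors.
Variables (k : fieldType) (U V W : lmodType k).

(** The finite substitute for Sweedler notation: scalars are absorbed into the left factors, so a
    coproduct can be handled as a list of pairs. *)
Lemma tens_sumE (t : tensor U V) :
  exists s : seq (U * V), t = \sum_(p <- s) p.1 ⊗ p.2.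
Proof.
have [s ->] := tensE t; exists [seq (p.1 *: p.2.1, p.2.2) | p <- s].
rewrite big_map; apply: eq_bigr => p _ /=.
by rewrite (linZ (bilinearl (tens_bilinear U V) p.2.2)).
Qed.

Lemma tlift_sum (f : U -> V -> W) (s : seq (U * V)) :
  is_bilinear f -> tlift f (\sum_(p <- s) p.1 ⊗ p.2) = \sum_(p <- s) f p.1 p.2.
Proof.
move=> fb; rewrite (lin_sum (tlift_linear fb)).
by apply: eq_bigr => p _; rewrite tlift_tens.
Qed.

Lemma tens_ext (f g : tensor U V -> W) : linear f -> linear g ->
  (forall u v, f (u ⊗ v) = g (u ⊗ v)) -> f =1 g.
Proof.
move=> fl gl fg; elim/tensor_ind => [|a u v t IH]; first by rewrite (lin0 fl) (lin0 gl).
by rewrite fl gl fg IH.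
Qed.

End Tensors.

Lemma comp_linear (k : fieldType) (U V W : lmodType k) (f : V -> W) (g : U -> V) :
  linear f -> linear g -> linear (fun u => f (g u)).
Proof. by move=> fl gl a x y /=; rewrite gl fl. Qed.

Lemma linear_add (k : fieldType) (U V : lmodType k) (f g : U -> V) :
  linear f -> linear g -> linear (fun u => f u + g u).
Proof. by move=> fl gl a x y; rewrite fl gl scalerDr addrACA. Qed.

Section LinearComp.
Variables (k : fieldType) (U V W : lmodType k).

Lemma linear_comp_bilinear (X : lmodType k) (h : W -> X) (f : U -> V -> W) :
  linear h -> is_bilinear f -> is_bilinear (fun u v => h (f u v)).
Proof. by move=> hl [f1 f2]; split=> [v|u] a x y /=; rewrite ?f1 ?f2 hl. Qed.

Lemma comp_tlift (X : lmodType k) (h : W -> X) (f : U -> V -> W) (t : tensor U V) :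
  linear h -> is_bilinear f -> h (tlift f t) = tlift (fun u v => h (f u v)) t.
Proof.
move=> hl fb; pose g t := h (tlift f t).
apply: (tens_ext (f := g)) => [||u v]; rewrite /g.
- exact: comp_linear hl (tlift_linear fb).
- exact/tlift_linear/linear_comp_bilinear.
- by rewrite !tlift_tens //; apply: linear_comp_bilinear.
Qed.

Lemma tlift_tmap (U' V' : lmodType k) (f : U -> U') (g : V -> V') (h : U' -> V' -> W) t :
  linear f -> linear g -> is_bilinear h ->
  tlift h (tmap f g t) = tlift (fun u v => h (f u) (g v)) t.
Proof.
move=> fl gl hb; have hfg := comp_bilinear hb fl gl.
apply: (tens_ext (f := fun t => tlift h (tmap f g t))) => [||u v].
- exact: comp_linear (tlift_linear hb) (tmap_linear fl gl).
- exact: tlift_linear.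
- by rewrite tmap_tens // !tlift_tens.
Qed.

End LinearComp.

Lemma tassoc_linear (k : fieldType) (U V W : lmodType k) :
  linear (@tassoc k U V W).
Proof.
have b1 (w : W) : is_bilinear (fun (u : U) (v : V) => u ⊗ (v ⊗ w)).
  exact: (comp_bilinear (tens_bilinear _ _)) (bilinearl (tens_bilinear V W) w).
apply: tlift_linear; split=> [w|t] /=; first exact: tlift_linear.
apply: (tlift_param (f := fun (w : W) (u : U) (v : V) => u ⊗ (v ⊗ w))) => // u v.
exact: comp_linear (bilinearr (tens_bilinear _ _) u) (bilinearr (tens_bilinear _ _) v).
Qed.

Lemma tmul_sum (k : fieldType) (A B : algType k) (s t : seq (A * B)) :
  tmul (\sum_(p <- s) p.1 ⊗ p.2) (\sum_(q <- t) q.1 ⊗ q.2)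
  = \sum_(p <- s) \sum_(q <- t) (p.1 * q.1) ⊗ (p.2 * q.2).
Proof.
have b1 (a : A) (b : B) : is_bilinear (fun c d => (a * c) ⊗ (b * d)).
  by apply: (comp_bilinear (tens_bilinear _ _)) => e x y; rewrite mulrDr -scalerAr.
rewrite /tmul tlift_sum; first by apply: eq_bigr => p _; rewrite tlift_sum.
have [h1 h2] := tens_bilinear A B; split=> [b|a] /=.
- apply: (tlift_param (f := fun a c d => (a * c) ⊗ (b * d))) => // u v e x y.
  by rewrite mulrDl -scalerAl (h1 (b * v)).
- apply: (tlift_param (f := fun b c d => (a * c) ⊗ (b * d))) => // u v e x y.
  by rewrite mulrDl -scalerAl (h2 (a * u)).
Qed.

Lemma linear_big_sum (k : fieldType) (U V : lmodType k) (I : Type) (r : seq I)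
    (f : I -> U -> V) :
  (forall i, linear (f i)) -> linear (fun u => \sum_(i <- r) f i u).
Proof.
by move=> fl a x y; rewrite scaler_sumr -big_split; apply: eq_bigr => i _; apply: fl.
Qed.

(** * Concatenation, deconcatenation and product in the stuffle algebra *)

Section StuffleTheory.
Variables (k : fieldType) (A : nuAlgebra k).
Implicit Types (x y u v : stuffle A) (a b : A).

Lemma stP (c : k) x y n : (c *: x + y) n = c *: x n + y n.
Proof. by []. Qed.

(** Defined by components rather than on words: tensor powers are nested to the right, so prepending
    a letter is a plain [⊗] and each component is available by computation. Length one is separate,
    since the first power is [A] itself. *)
Definition st_cons_fam a (x : stuffle A) n : tpow A n :=
  match n with
  | 0 => 0
  | n'.+1 =>
    match n' return tpow A n' -> tpow A n'.+1 with
    | 0 => fun c : k^o => (c : k) *: a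
    | _.+1 => fun t => a ⊗ t
    end (x n')
  end.

Lemma st_cons_fin a x : exists N, forall n, (N <= n)%N -> st_cons_fam a x n = 0.
Proof.
have [N xN] := dfam_fin x; exists N.+1 => -[|[|n]] //= lt; rewrite xN //.
  by rewrite scale0r.
by rewrite (lin0 (bilinearr (tens_bilinear A (tpow A n.+1)) a)).
Qed.

Definition st_cons a x : stuffle A := DSum (st_cons_fin a x).

Lemma st_cons_bilinear : is_bilinear st_cons.
Proof.
split=> [x|a] c u v; apply: dsum_eqP => -[|[|n]]; rewrite stP /=.
- by rewrite scaler0 addr0.
- by rewrite scalerDr !scalerA mulrC.
- exact: (bilinearl (tens_bilinear _ _)).
- by rewrite scaler0 addr0.
- by rewrite scalerDl scalerA.
- exact: (bilinearr (tens_bilinear _ _)).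
Qed.

Lemma st_cons1E a x : st_cons a x 1%N = st_counit x *: a.
Proof. by []. Qed.

Lemma st_consSSE a x n : st_cons a x n.+2 = a ⊗ x n.+1.
Proof. by []. Qed.

Lemma st_cons_word a (s : seq A) : st_cons a (word s) = word (a :: s).
Proof.
apply: dsum_eqP => n; rewrite /word.
have [<-|nm] := eqVneq (size (a :: s)) n.
  rewrite dsum_injE; case: s => [|b s].
    by rewrite st_cons1E /st_counit dsum_injE scale1r.
  by rewrite st_consSSE dsum_injE.
rewrite (dsum_injN _ nm); case: n nm => [|[|n]] // nm.
  by rewrite st_cons1E /st_counit dsum_injN ?scale0r.
by rewrite st_consSSE dsum_injN // (lin0 (bilinearr (tens_bilinear A (tpow A n.+1)) a)).
Qed.

Lemma st_ext (W : lmodType k) (f g : stuffle A -> W) : linear f -> linear g ->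
  (forall s, f (word s) = g (word s)) -> f =1 g.
Proof.
move=> fl gl fg; elim/word_ind => [|a s x IH]; first by rewrite (lin0 fl) (lin0 gl).
by rewrite fl gl fg IH.
Qed.

Lemma st_mul1l : left_id (st_one A) (@st_mul k A).
Proof.
apply: st_ext => // [|s]; last exact: st_mul0w.
exact: (bilinearr (st_mul_bilinear A)).
Qed.

Lemma st_mul1r : right_id (st_one A) (@st_mul k A).
Proof.
apply: st_ext => // [|s]; last exact: st_mulw0.
exact: (bilinearl (st_mul_bilinear A)).
Qed.

Lemma st_mul_rcons_rcons u v a b :
  st_mul (st_rcons u a) (st_rcons v b)
  = st_rcons (st_mul u (st_rcons v b)) a + st_rcons (st_mul (st_rcons u a) v) b
    + st_rcons (st_mul u v) (nu_mul a b).
Proof.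
have r1 := bilinearl (st_rcons_bilinear A).
have m1 := bilinearl (st_mul_bilinear A); have m2 := bilinearr (st_mul_bilinear A).
move: u; apply: (st_ext
    (f := fun u => st_mul (st_rcons u a) (st_rcons v b))
    (g := fun u => st_rcons (st_mul u (st_rcons v b)) a
      + st_rcons (st_mul (st_rcons u a) v) b + st_rcons (st_mul u v) (nu_mul a b)))
    => [||s].
- exact: comp_linear (m1 _) (r1 _).
- apply: linear_add; first apply: linear_add.
  + exact: comp_linear (r1 _) (m1 _).
  + exact: comp_linear (r1 _) (comp_linear (m1 _) (r1 _)).
  + exact: comp_linear (r1 _) (m1 _).
move: v; apply: (st_ext
    (f := fun v => st_mul (st_rcons (word s) a) (st_rcons v b))
    (g := fun v => st_rcons (st_mul (word s) (st_rcons v b)) a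
      + st_rcons (st_mul (st_rcons (word s) a) v) b
      + st_rcons (st_mul (word s) v) (nu_mul a b)))
    => [||r].
- exact: comp_linear (m2 _) (r1 _).
- apply: linear_add; first apply: linear_add.
  + exact: comp_linear (r1 _) (comp_linear (m2 _) (r1 _)).
  + exact: comp_linear (r1 _) (m2 _).
  + exact: comp_linear (r1 _) (m2 _).
by rewrite !st_rcons_word st_mul_rcons.
Qed.

(** A word starting with [a] is cut either before [a], which gives the first term, or after it,
    which is a cut of the remaining word. *)
Lemma st_coprod_cons a x :
  st_coprod (st_cons a x)
  = st_one A ⊗ st_cons a x + tmap (st_cons a) idfun (st_coprod x).
Proof.
have cl := bilinearr st_cons_bilinear a.
have idl : linear (idfun : stuffle A -> stuffle A) by [].
move: x; apply: st_ext => [||s].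
- exact: comp_linear (@st_coprod_linear _ A) cl.
- move=> c x y; rewrite cl (st_coprod_linear c) (tmap_linear cl idl).
  by rewrite (bilinearr (tens_bilinear _ _)) scalerDr addrACA.
rewrite st_cons_word !st_coprod_word big_ord_recl /=; congr (_ + _).
rewrite (lin_sum (tmap_linear cl idl)); apply: eq_bigr => r _.
by rewrite tmap_tens // st_cons_word.
Qed.

Lemma word1E (s : seq A) :
  (word s : stuffle A) 1%N = (if size s == 1 then head 0 s else 0) :> A.
Proof.
case: eqP => [|/eqP] s1; last exact: dsum_injN.
by case: s s1 => [|a [|]] // _; apply: dsum_injE.
Qed.

(* [v 1%N] is the component of length one of [v], a letter. *)
Lemma st_rcons_coprod x :
  x = (st_counit x : k) *: st_one A + tlift (fun u v => st_rcons u (v 1%N)) (st_coprod x).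
Proof.
have fb : is_bilinear (fun u v : stuffle A => st_rcons u (v 1%N : A)).
  exact: (comp_bilinear (st_rcons_bilinear A)).
pose g x := (st_counit x : k) *: st_one A
  + tlift (fun u v => st_rcons u (v 1%N)) (st_coprod x).
apply: (st_ext (f := idfun) (g := g)) => // [c u v|s]; rewrite /g.
  rewrite (st_coprod_linear c) (tlift_linear fb) scalerDr addrACA scalerA.
  by congr (_ + _); rewrite /st_counit stP scalerDl.
rewrite st_coprod_word (lin_sum (tlift_linear fb)).
under eq_bigr => r _ do rewrite tlift_tens // word1E size_drop.
case/lastP: s => [|s a].
  rewrite big_ord1 (lin0 (bilinearr (st_rcons_bilinear A) _)) addr0.
  by rewrite /st_counit /word dsum_injE scale1r.
have -> : st_counit (word (rcons s a)) = 0 by apply: dsum_injN; rewrite size_rcons.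
rewrite scale0r add0r size_rcons.
(* Only the cut just before the last letter leaves a suffix of length one; the final cut leaves the
   empty word, and the earlier ones leave longer suffixes. *)
rewrite !big_ord_recr /= subnn subSnn big1 /= => [|r _].
  rewrite (lin0 (bilinearr (st_rcons_bilinear A) _)) add0r addr0.
  by rewrite -cats1 take_size_cat ?drop_size_cat ?st_rcons_word ?cats1.
rewrite subSn 1?ltnW // eqSS subn_eq0 leqNgt ltn_ord.
exact: lin0 (bilinearr (st_rcons_bilinear A) _).
Qed.

Lemma st_coprod_one : st_coprod (st_one A) = st_one A ⊗ st_one A.
Proof. by rewrite st_coprod_word big_ord1. Qed.

Lemma tmap_cons_bilinear :
  is_bilinear (fun a (t : tensor (stuffle A) (stuffle A)) => tmap (st_cons a) idfun t).
Proof.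
have bil a : is_bilinear (fun x y => st_cons a x ⊗ y).
  exact: (tmap_bilinear (bilinearr st_cons_bilinear a)).
split=> [t|a]; last exact: tlift_linear.
apply: (tlift_param (f := fun a x y => st_cons a x ⊗ y)) => // x y.
exact: comp_linear (bilinearl (tens_bilinear _ _) y) (bilinearl st_cons_bilinear x).
Qed.

(** The stuffle recursion on last letters for elements with a constant term: the products with [c]
    and [d] are absorbed by keeping the whole of [v] and [u] in the two one-sided sums. This is the
    shape that [st_map_mul_rec] produces. *)
Lemma st_mul_expand (s t : seq (stuffle A * A)) (c d : k) u v :
  u = c *: st_one A + \sum_(p <- s) st_rcons p.1 p.2 ->
  v = d *: st_one A + \sum_(q <- t) st_rcons q.1 q.2 ->
  st_mul u v = (c * d) *: st_one A
    + (\sum_(p <- s) \sum_(q <- t) st_rcons (st_mul p.1 q.1) (nu_mul p.2 q.2)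
       + \sum_(p <- s) st_rcons (st_mul p.1 v) p.2)
    + \sum_(q <- t) st_rcons (st_mul u q.1) q.2.
Proof.
have r1 := bilinearl (st_rcons_bilinear A).
have m1 := bilinearl (st_mul_bilinear A); have m2 := bilinearr (st_mul_bilinear A).
pose U : stuffle A := \sum_(p <- s) st_rcons p.1 p.2.
pose V : stuffle A := \sum_(q <- t) st_rcons q.1 q.2.
rewrite -/U -/V => uE vE.
have uq q : st_rcons (st_mul u q.1) q.2 = c *: st_rcons q.1 q.2
    + \sum_(p <- s) st_rcons (st_mul (st_rcons p.1 p.2) q.1) q.2.
  rewrite uE m1 r1 st_mul1l; congr (_ + _).
  by rewrite (lin_sum (m1 _)) (lin_sum (r1 _)).
have pv p : st_rcons (st_mul p.1 v) p.2 = d *: st_rcons p.1 p.2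
    + \sum_(q <- t) st_rcons (st_mul p.1 (st_rcons q.1 q.2)) p.2.
  rewrite vE m2 r1 st_mul1r; congr (_ + _).
  by rewrite (lin_sum (m2 _)) (lin_sum (r1 _)).
under [X in _ = _ + (_ + X) + _]eq_bigr => p _ do rewrite pv.
under [X in _ = _ + X]eq_bigr => q _ do rewrite uq.
rewrite !big_split /= -!scaler_sumr -/U -/V [X in _ = _ + (_ + X)]exchange_big.
have mE : st_mul u v
    = (c * d) *: st_one A + c *: V + (d *: U + st_mul U V).
  by rewrite uE vE m1 !m2 !st_mul1l !st_mul1r scalerDr scalerA.
rewrite {}mE.
have -> : st_mul U V = \sum_(p <- s) \sum_(q <- t)
    st_rcons (st_mul p.1 (st_rcons q.1 q.2)) p.2
  + \sum_(p <- s) \sum_(q <- t) st_rcons (st_mul (st_rcons p.1 p.2) q.1) q.2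
  + \sum_(p <- s) \sum_(q <- t) st_rcons (st_mul p.1 q.1) (nu_mul p.2 q.2).
  rewrite (lin_sum (m1 _)) -!big_split; apply: eq_bigr => p _.
  rewrite (lin_sum (m2 _)) -!big_split; apply: eq_bigr => q _.
  exact: st_mul_rcons_rcons.
have abel (Z : zmodType) (e a b x y z : Z) :
    e + a + (b + (x + y + z)) = e + (z + (b + x)) + (a + y).
  rewrite -!addrA; congr (e + _).
  by rewrite [RHS]addrC -!addrA [LHS]addrCA [X in b + X]addrCA.
exact: abel.
Qed.

End StuffleTheory.

(** * The projection onto the augmentation ideal and the iterated reduced coproducts *)

Section Augmentation.
Variables (k : fieldType) (H : bialgebra k).
Local Notation A := (aug_alg H).
Local Notation p := (@aug_proj k H).
Implicit Types x y h : H.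

Lemma aug_val_inj : injective (@aug_val k H).
Proof. exact: val_inj. Qed.

Lemma aug_proj_linear : linear p.
Proof.
move=> a x y; apply: aug_val_inj; rewrite aug_val_linear /=.
rewrite linearP scalerBr scalerDl opprD addrACA; congr (_ - _ + _).
by rewrite scalerA.
Qed.

Lemma aug_proj1 : p 1 = 0.
Proof.
apply: aug_val_inj; rewrite (lin0 (@aug_val_linear k H)) /=.
by rewrite counit1 scale1r subrr.
Qed.

(** Multiply x = p'(x) + eta(x) 1 by y = p'(y) + eta(y) 1; the multiple of 1 is killed by p'. *)
Lemma aug_projM x y : p (x * y) =
  nu_mul (p x) (p y) + ((counit x : k) *: p y + (counit y : k) *: p x) :> A.
Proof.
apply: aug_val_inj.
rewrite (linD (@aug_val_linear k H)) (linD (@aug_val_linear k H)).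
rewrite !(linZ (@aug_val_linear k H)) /= counitM.
rewrite mulrBl !mulrBr mulr_algl mulr_algr mulr_algl !scalerBr !scalerA [_ * counit x]mulrC.
have abel (Z : zmodType) (a b c d : Z) : a - d = a - b - (c - d) + (c - d + (b - d)).
  by rewrite addrA subrK addrA subrK.
exact: abel.
Qed.

Lemma counit_suml (s : seq (H * H)) h :
  coprod h = \sum_(q <- s) q.1 ⊗ q.2 -> h = \sum_(q <- s) (counit q.1 : k) *: q.2.
Proof.
move=> hs; rewrite -[LHS]counitl hs tlift_sum //.
by split=> [y|x] a u v; rewrite ?linearP /= ?scalerDl ?scalerDr !scalerA // mulrC.
Qed.

Lemma counit_sumr (s : seq (H * H)) h :
  coprod h = \sum_(q <- s) q.1 ⊗ q.2 -> h = \sum_(q <- s) (counit q.2 : k) *: q.1.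
Proof.
move=> hs; rewrite -[LHS]counitr hs tlift_sum //.
by split=> [y|x] a u v; rewrite ?linearP /= ?scalerDl ?scalerDr !scalerA // mulrC.
Qed.

(* [red_coprod] extended to all of [H]; at [n = 0] this is the counit. *)
Definition red_iter n h : tpow A n := tpow_map p (iter_coprod n h).

Lemma tpow_map_linear (U V : lmodType k) (f : U -> V) n :
  linear f -> linear (tpow_map f (n := n)).
Proof.
by move=> fl; elim: n => [|[|n] IH] //; apply: tmap_linear.
Qed.

Lemma iter_coprod_linear n : linear (@iter_coprod k H n).
Proof.
elim: n => [|[|n] IH] //; first exact: linearP.
exact: comp_linear (tmap_linear _ IH) (linearP _).
Qed.

Lemma red_iter_linear n : linear (red_iter n).
Proof.
exact: comp_linear (tpow_map_linear aug_proj_linear) (iter_coprod_linear n).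
Qed.

Lemma red_tens_bilinear n : is_bilinear (fun x y => p x ⊗ red_iter n y).
Proof. exact: tmap_bilinear aug_proj_linear (red_iter_linear n). Qed.

Lemma red_iterSS n h :
  red_iter n.+2 h = tlift (fun x y => p x ⊗ red_iter n.+1 y) (coprod h).
Proof.
have ptl := tpow_map_linear (n := n.+1) aug_proj_linear.
exact: (tlift_tmap (f := idfun) (coprod h) _ (iter_coprod_linear n.+1)
  (tmap_bilinear aug_proj_linear ptl)).
Qed.

(** * Vanishing of the reduced coproducts along the filtration *)

Section Filtration.
Variable F : nat -> {pred H}.
Hypothesis FP : connected_filtration F.

Lemma tlift_coprod0 (W : lmodType k) (B : H -> H -> W) N h :
  is_bilinear B -> h \in F N ->
  (forall i x y, (i <= N)%N -> x \in F i -> y \in F (N - i)%N -> B x y = 0) ->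
  tlift B (coprod h) = 0.
Proof.
move=> Bb /(filt_coprod FP) Fh B0; elim: Fh => [|a u v [i [x [y [le Fx Fy ->]]]] _ IH].
  exact: lin0 (tlift_linear Bb).
by rewrite (tlift_linear Bb) IH tlift_tens // (B0 i) // scaler0 addr0.
Qed.

Lemma aug_proj_filt0 x : x \in F 0%N -> p x = 0.
Proof.
move=> /(filt_connected FP)[c ->].
by rewrite (linZ aug_proj_linear) aug_proj1 scaler0.
Qed.

(** Every tensor factor costs at least one degree: in F_i ⊗ F_(N-i) the case i = 0 is killed by p',
    since F_0 = k1, and for i > 0 the right factor has smaller degree, so the induction on [n]
    applies. *)
Lemma red_iter_filt n N h : (N < n)%N -> h \in F N -> red_iter n h = 0.
Proof.
elim: n N h => [|[|n] IH] [|N] h //; try by move=> _; apply: aug_proj_filt0.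
- move=> _ Fh; rewrite red_iterSS; apply: (tlift_coprod0 (red_tens_bilinear n.+1) Fh).
  move=> i x y; rewrite leqn0 => /eqP -> Fx _.
  by rewrite aug_proj_filt0 // (lin0 (bilinearl (tens_bilinear _ _) _)).
- move=> lt Fh; rewrite red_iterSS; apply: (tlift_coprod0 (red_tens_bilinear n.+1) Fh).
  move=> [|i] x y le Fx Fy.
    by rewrite aug_proj_filt0 // (lin0 (bilinearl (tens_bilinear _ _) _)).
  rewrite (IH (N - i)%N) ?(lin0 (bilinearr (tens_bilinear _ _) _)) //.
  by rewrite (leq_ltn_trans (leq_subr _ _)).
Qed.

End Filtration.

(** * Induction on a connected bialgebra and the map iota *)

Section Stuffle_map.
Hypothesis hH : connected H.

(* Modulo tensors with a factor in [k 1], the coproduct of [F_N] only involves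
   factors from [F_i] with [i < N]; this packages the induction on [N]. *)
Lemma connected_ind (P : H -> Prop) :
  (forall h,
    (forall (W : lmodType k) (B : H -> H -> W), is_bilinear B ->
       (forall x y, P x -> P y -> B x y = 0) ->
       (forall y, B 1 y = 0) -> (forall x, B x 1 = 0) ->
       tlift B (coprod h) = 0) -> P h) ->
  forall h, P h.
Proof.
have [F FP] := hH => step h; have [N] := filt_cover FP h.
elim/ltn_ind: N h => N IH h Fh; apply: step => W B Bb BP B1l B1r.
apply: (tlift_coprod0 FP Bb Fh) => i x y le Fx Fy.
have [i0|i_gt0] := posnP i.
  move: Fx; rewrite i0 => /(filt_connected FP)[c ->].
  by rewrite (linZ (bilinearl Bb y)) B1l scaler0.
have [iN|ltN] := leqP N i.
  move: Fy; have -> : (N - i = 0)%N by apply/eqP.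
  move=> /(filt_connected FP)[c ->].
  by rewrite (linZ (bilinearr Bb x)) B1r scaler0.
apply: BP; first exact: IH Fx.
by apply: IH Fy; rewrite ltn_subrL i_gt0 (leq_trans _ ltN).
Qed.

Lemma red_iter_fin h : exists N, forall n, (N <= n)%N -> red_iter n h = 0.
Proof.
have [F FP] := hH; have [N Fh] := filt_cover FP h.
by exists N.+1 => n lt; apply: red_iter_filt Fh.
Qed.

(** This is iota on all of [H]. Given by its components, it has eta(h) in length 0 and p'(h) in
    length 1 by computation. *)
Definition st_map h : stuffle A := DSum (red_iter_fin h).

Lemma st_map_linear : linear st_map.
Proof. by move=> a x y; apply: dsum_eqP => n; apply: red_iter_linear. Qed.

Lemma st_cons_map_bilinear : is_bilinear (fun x y => st_cons (p x) (st_map y)).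
Proof. exact: comp_bilinear (st_cons_bilinear A) aug_proj_linear st_map_linear. Qed.

(** Checked length by length: in length 0 only the counit term remains, length 1 is the right counit
    law, and from length 2 on it is the recursive definition of the iterated coproduct. *)
Lemma st_map_cons h : st_map h =
  (counit h : k) *: st_one A + tlift (fun x y => st_cons (p x) (st_map y)) (coprod h).
Proof.
apply: dsum_eqP => n; rewrite stP.
rewrite (comp_tlift _ (@dfam_linear k (tpow A) n) st_cons_map_bilinear).
have [s hs] := tens_sumE (coprod h).
have bn : is_bilinear (fun x y => st_cons (p x) (st_map y) n).
  exact: linear_comp_bilinear (@dfam_linear k (tpow A) n) st_cons_map_bilinear.
case: n bn => [|[|n]] bn.
- rewrite hs tlift_sum // big1 // addr0 dsum_injE.
  by rewrite [RHS]mulr1.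
- rewrite dsum_injN // scaler0 add0r hs tlift_sum //.
  have -> : st_map h 1%N = p (\sum_(q <- s) (counit q.2 : k) *: q.1).
    by rewrite -(counit_sumr hs).
  rewrite (lin_sum aug_proj_linear).
  by apply: eq_bigr => q _; rewrite (linZ aug_proj_linear).
- rewrite dsum_injN // scaler0 add0r.
  exact: red_iterSS.
Qed.

Lemma st_map1 : st_map 1 = st_one A.
Proof.
rewrite st_map_cons counit1 coprod1 tlift_tens; last exact: st_cons_map_bilinear.
by rewrite aug_proj1 (lin0 (bilinearl (st_cons_bilinear A) _)) scale1r addr0.
Qed.

(** * Compatibility with coproducts *)

Lemma st_coprod_map_rec h : st_coprod (st_map h) = st_one A ⊗ st_map h +
  tlift (fun x y => tmap (st_cons (p x)) idfun (st_coprod (st_map y))) (coprod h).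
Proof.
have ml := st_map_linear; have cl := @st_coprod_linear k A.
have bil : is_bilinear
    (fun x y => tmap (st_cons (p x)) idfun (st_coprod (st_map y))).
  exact: comp_bilinear (tmap_cons_bilinear A) aug_proj_linear (comp_linear cl ml).
have [s hs] := tens_sumE (coprod h).
have mE := st_map_cons h; rewrite hs (tlift_sum _ st_cons_map_bilinear) in mE.
rewrite mE cl (bilinearr (tens_bilinear _ _)) st_coprod_one hs tlift_sum // -addrA.
(* The cuts before the first letter, together with the constant term, reassemble to 1 ⊗ iota(h). *)
congr (_ + _); rewrite (lin_sum cl) (lin_sum (bilinearr (tens_bilinear _ _) _)).
by rewrite -big_split; apply: eq_bigr => q _; apply: st_coprod_cons.
Qed.

(** Expand the left factor by [st_map_cons]. The counit part collapses to 1 ⊗ iota(h); the rest is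
    the sum of p'(h1).iota(h2) ⊗ iota(h3), which coassociativity regroups as iota ⊗ iota on the
    coproduct of the second factor. *)
Lemma tmap_map_rec h : tmap st_map st_map (coprod h) = st_one A ⊗ st_map h +
  tlift (fun x y => tmap (st_cons (p x)) idfun (tmap st_map st_map (coprod y)))
        (coprod h).
Proof.
have ml := st_map_linear; have mml := tmap_linear ml ml.
have cml := st_cons_map_bilinear.
have idl (U : lmodType k) : linear (idfun : U -> U) by [].
have dl : linear (@coprod k H) by apply: linearP.
pose B x (t : tensor H H) := tmap (st_cons (p x)) idfun (tmap st_map st_map t).
have Bb : is_bilinear B := comp_bilinear (tmap_cons_bilinear A) aug_proj_linear mml.
have tb := bilinearl (tens_bilinear (stuffle A) (stuffle A)).
have -> : tlift (fun x y => tmap (st_cons (p x)) idfun (tmap st_map st_map (coprod y)))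
    (coprod h) = tlift B (tmap idfun coprod (coprod h)) by rewrite tlift_tmap.
(* With the other bracketing, [B] rebuilds the non-constant part of [st_map_cons] in the left
   factor. *)
have Bassoc u v : tlift B (tassoc (u ⊗ v))
    = tlift (fun x y => st_cons (p x) (st_map y)) u ⊗ st_map v.
  move: u; apply: (tens_ext (f := fun u => tlift B (tassoc (u ⊗ v)))) => [||x y].
  - apply: comp_linear (tlift_linear Bb) (comp_linear (@tassoc_linear _ _ _ _) _).
    exact: bilinearl (tens_bilinear _ _) v.
  - exact: comp_linear (tb _) (tlift_linear cml).
  rewrite tassoc_tens !tlift_tens // /B !tmap_tens //.
  exact: bilinearr (st_cons_bilinear A) _.
have [s hs] := tens_sumE (coprod h).
rewrite -coprodA {2}hs (lin_sum (tmap_linear dl (idl _))).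
rewrite (lin_sum (@tassoc_linear _ _ _ _)) (lin_sum (tlift_linear Bb)).
rewrite {1}hs (lin_sum mml) {1}(counit_suml hs) (lin_sum ml).
rewrite (lin_sum (bilinearr (tens_bilinear _ _) _)) -big_split.
apply: eq_bigr => q _; rewrite !tmap_tens // Bassoc [in LHS]st_map_cons tb.
by rewrite (linZ ml) (linZ (bilinearr (tens_bilinear _ _) _)).
Qed.

Lemma st_coprod_map h : st_coprod (st_map h) = tmap st_map st_map (coprod h).
Proof.
have ml := st_map_linear; have mml := tmap_linear ml ml.
pose E h := st_coprod (st_map h) - tmap st_map st_map (coprod h).
suff : E h = 0 by move/eqP; rewrite subr_eq0 => /eqP.
have dl : linear (@coprod k H) by apply: linearP.
have cl := comp_linear (@st_coprod_linear k A) ml.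
have tcb := tmap_cons_bilinear A.
have El : linear E.
  move=> a x y; rewrite /E cl (comp_linear mml dl).
  by rewrite scalerBr opprD addrACA.
have Bb : is_bilinear (fun x y => tmap (st_cons (p x)) idfun (E y)).
  exact: comp_bilinear tcb aug_proj_linear El.
have p10 t : tmap (st_cons (p 1)) idfun t = 0 :> tensor (stuffle A) (stuffle A).
  by rewrite aug_proj1 (lin0 (bilinearl tcb t)).
have E1 : E 1 = 0.
  rewrite /E st_map1 st_coprod_one coprod1 tmap_tens // st_map1; exact: subrr.
elim/connected_ind: h => h IH.
(* Both recursions have the same term 1 ⊗ iota(h), so their difference [E] satisfies the homogeneous
   one, to which the induction applies because p'(1) = 0 and E(1) = 0. *)
have -> : E h = tlift (fun x y => tmap (st_cons (p x)) idfun (E y)) (coprod h).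
  rewrite /E st_coprod_map_rec tmap_map_rec.
  have [s hs] := tens_sumE (coprod h).
  have b1 := comp_bilinear tcb aug_proj_linear cl.
  have b2 := comp_bilinear tcb aug_proj_linear (comp_linear mml dl).
  rewrite !hs !tlift_sum // opprD addrACA subrr add0r -sumrB.
  by apply: eq_bigr => q _; rewrite (linB (bilinearr tcb _)).
apply: IH => // [x y _ ->|y|x]; [exact: lin0 (bilinearr tcb _)|exact: p10|].
by rewrite E1 (lin0 (bilinearr tcb _)).
Qed.

(** * Compatibility with products *)

Lemma st_rcons_map_bilinear : is_bilinear (fun x y => st_rcons (st_map x) (p y)).
Proof. exact: comp_bilinear (st_rcons_bilinear A) st_map_linear aug_proj_linear. Qed.

(** Split off last letters in iota(h) by [st_rcons_coprod], then move the coproduct through iota;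
    the length-one component of iota(h2) is p'(h2). *)
Lemma st_map_rcons (s : seq (H * H)) h : coprod h = \sum_(q <- s) q.1 ⊗ q.2 ->
  st_map h = (counit h : k) *: st_one A
    + \sum_(q <- s) st_rcons (st_map q.1) (p q.2).
Proof.
move=> hs; rewrite [LHS]st_rcons_coprod st_coprod_map; congr (_ + _).
have b1 : is_bilinear (fun u v : stuffle A => st_rcons u (v 1%N : A)).
  exact: (comp_bilinear (st_rcons_bilinear A)).
rewrite tlift_tmap //; try exact: st_map_linear.
by rewrite hs (tlift_sum _ st_rcons_map_bilinear).
Qed.

(** Apply [st_map_rcons] to the product of the two coproducts and expand the last letter by
    [aug_projM]. In the terms carrying a counit, the counit law collapses one of the two sums and
    restores [y] or [x]. *)
Lemma st_map_mul_rec (s t : seq (H * H)) x y :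
  coprod x = \sum_(q <- s) q.1 ⊗ q.2 -> coprod y = \sum_(r <- t) r.1 ⊗ r.2 ->
  st_map (x * y) = ((counit x : k) * (counit y : k)) *: st_one A
    + (\sum_(q <- s) \sum_(r <- t)
          st_rcons (st_map (q.1 * r.1)) (nu_mul (p q.2) (p r.2))
       + \sum_(q <- s) st_rcons (st_map (q.1 * y)) (p q.2))
    + \sum_(r <- t) st_rcons (st_map (x * r.1)) (p r.2).
Proof.
move=> xs yt; have ml := st_map_linear.
have r1 := bilinearl (st_rcons_bilinear A); have r2 := bilinearr (st_rcons_bilinear A).
pose st := [seq (q.1 * r.1, q.2 * r.2) | q <- s, r <- t].
have xyst : coprod (x * y) = \sum_(q <- st) q.1 ⊗ q.2.
  by rewrite coprodM xs yt tmul_sum big_allpairs_dep.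
rewrite (st_map_rcons xyst) counitM -addrA; congr (_ + _); rewrite big_allpairs_dep /=.
have -> : \sum_(q <- s) st_rcons (st_map (q.1 * y)) (p q.2) =
    \sum_(q <- s) \sum_(r <- t)
      (counit r.2 : k) *: st_rcons (st_map (q.1 * r.1)) (p q.2).
  apply: eq_bigr => q _; rewrite {1}(counit_sumr yt) mulr_sumr (lin_sum ml).
  rewrite (lin_sum (r1 _)); apply: eq_bigr => r _.
  by rewrite -scalerAr (linZ ml) (linZ (r1 _)).
have -> : \sum_(r <- t) st_rcons (st_map (x * r.1)) (p r.2) =
    \sum_(q <- s) \sum_(r <- t)
      (counit q.2 : k) *: st_rcons (st_map (q.1 * r.1)) (p r.2).
  rewrite exchange_big; apply: eq_bigr => r _.
  rewrite {1}(counit_sumr xs) mulr_suml (lin_sum ml).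
  rewrite (lin_sum (r1 _)); apply: eq_bigr => q _.
  by rewrite -scalerAl (linZ ml) (linZ (r1 _)).
rewrite -!big_split; apply: eq_bigr => q _ /=.
rewrite -!big_split; apply: eq_bigr => r _ /=.
rewrite aug_projM !(linD (r2 _)) !(linZ (r2 _)) -addrA; congr (_ + _).
exact: addrC.
Qed.

Lemma st_map_mul x y : st_map (x * y) = st_mul (st_map x) (st_map y).
Proof.
have ml := st_map_linear; have pl := aug_proj_linear.
have r1 := bilinearl (st_rcons_bilinear A); have r2 := bilinearr (st_rcons_bilinear A).
pose D x y := st_map (x * y) - st_mul (st_map x) (st_map y).
suff : D x y = 0 by move/eqP; rewrite subr_eq0 => /eqP.
have Dl z : linear (D^~ z).
  move=> a u v; rewrite /D mulrDl -scalerAl !ml (bilinearl (st_mul_bilinear A)).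
  by rewrite scalerBr opprD addrACA.
have Dr z : linear (D z).
  move=> a u v; rewrite /D mulrDr -scalerAr !ml (bilinearr (st_mul_bilinear A)).
  by rewrite scalerBr opprD addrACA.
have D1l z : D 1 z = 0 by rewrite /D mul1r st_map1 st_mul1l; exact: subrr.
have D1r z : D z 1 = 0 by rewrite /D mulr1 st_map1 st_mul1r; exact: subrr.
(* Subtract the expansions of iota(uv) and iota(u) iota(v); they have the same constant term and
   match sum by sum. *)
have Drec u v s t : coprod u = \sum_(q <- s) q.1 ⊗ q.2 ->
    coprod v = \sum_(r <- t) r.1 ⊗ r.2 ->
    D u v = \sum_(q <- s) (\sum_(r <- t)
        st_rcons (D q.1 r.1) (nu_mul (p q.2) (p r.2)) + st_rcons (D q.1 v) (p q.2))
      + \sum_(r <- t) st_rcons (D u r.1) (p r.2).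
  move=> us vt; rewrite {1}/D (st_map_mul_rec us vt).
  pose sm (z : seq (H * H)) := [seq (st_map q.1, p q.2) | q <- z].
  rewrite (@st_mul_expand _ _ (sm s) (sm t) (counit u : k) (counit v : k)); last 2 first.
  - by rewrite big_map; apply: st_map_rcons.
  - by rewrite big_map; apply: st_map_rcons.
  rewrite !big_map /=.
  have abel (Z : zmodType) (e a b c a' b' c' : Z) :
      e + (a + b) + c - (e + (a' + b') + c') = (a - a') + (b - b') + (c - c').
    rewrite opprD addrACA; congr (_ + _).
    by rewrite opprD addrACA subrr add0r opprD addrACA.
  rewrite abel -!sumrB -big_split /=; congr (_ + _); apply: eq_bigr => q _; last first.
    by rewrite /D (linB (r1 _)).
  rewrite big_map -sumrB /D (linB (r1 _)); congr (_ + _); apply: eq_bigr => r _.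
  by rewrite (linB (r1 _)).
(* Two nested inductions: the outer one, uniform in [y], removes every term where the first argument
   of [D] is a factor of the coproduct of [x]; the inner one treats the remaining sum over the
   coproduct of [y]. *)
elim/connected_ind: x y => x IHx y.
have [s xs] := tens_sumE (coprod x).
have Dx z t : coprod z = \sum_(r <- t) r.1 ⊗ r.2 ->
    D x z = \sum_(r <- t) st_rcons (D x r.1) (p r.2).
  move=> zt; rewrite (Drec _ _ _ _ xs zt).
  (* [B] collects all terms indexed by the coproduct of [x], with that of [z] frozen as the list
     [t], so that it is bilinear as the induction requires. *)
  pose B u v := \sum_(r <- t) st_rcons (D u r.1) (nu_mul (p v) (p r.2))
                + st_rcons (D u z) (p v).
  have m1 := bilinearl (nu_mul_bilinear A).
  have Bb : is_bilinear B.
    split=> [v|u]; apply: linear_add.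
    - by apply: linear_big_sum => r; apply: comp_linear (r1 _) (Dl _).
    - exact: comp_linear (r1 _) (Dl _).
    - apply: linear_big_sum => r.
      exact: comp_linear (r2 _) (comp_linear (m1 _) pl).
    - exact: comp_linear (r2 _) pl.
  rewrite -(tlift_sum _ Bb) -xs IHx ?add0r // => [u v Pu _|v|u]; rewrite /B.
  - rewrite Pu (lin0 (r1 _)) addr0; apply: big1 => r _; by rewrite Pu (lin0 (r1 _)).
  - rewrite D1l (lin0 (r1 _)) addr0; apply: big1 => r _; by rewrite D1l (lin0 (r1 _)).
  - rewrite aug_proj1 (lin0 (r2 _)) addr0; apply: big1 => r _.
    by rewrite (lin0 (m1 _)) (lin0 (r2 _)).
elim/connected_ind: y => y IHy.
have [t yt] := tens_sumE (coprod y).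
have Bb : is_bilinear (fun u v => st_rcons (D x u) (p v)).
  exact: comp_bilinear (st_rcons_bilinear A) (Dr x) pl.
rewrite (Dx _ _ yt) -(tlift_sum _ Bb) -yt; apply: IHy => // [u v -> _|v|u].
- exact: lin0 (r1 _).
- by rewrite D1r (lin0 (r1 _)).
- by rewrite aug_proj1 (lin0 (r2 _)).
Qed.

(** * Injectivity and the defining formula *)

Lemma st_map_inj : injective st_map.
Proof.
move=> x y xy.
have x0 : counit x = counit y :> k := congr1 (fun u : stuffle A => u 0%N) xy.
have : p x = p y := congr1 (fun u : stuffle A => u 1%N) xy.
by move/(congr1 (@aug_val k H)) => /=; rewrite x0 => /addIr.
Qed.

Lemma st_map_aug (a : A) N : (forall n, (N < n)%N -> red_coprod n a = 0) ->
  st_map (aug_val a) = \sum_(1 <= n < N.+1) dsum_inj (red_coprod n a).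
Proof.
move=> aN; apply: dsum_eqP => m; rewrite (lin_sum (@dfam_linear k (tpow A) m)).
rewrite [LHS]/(red_coprod m a).
have [mN|mN] := boolP (m \in index_iota 1 N.+1).
  rewrite (bigD1_seq m) ?iota_uniq // dsum_injE big1 => [|n nm].
    exact: esym (addr0 _).
  exact: dsum_injN.
rewrite big1_seq => [|n /andP[_ nN]]; last first.
  by rewrite dsum_injN //; apply: contraNneq mN => <-.
(* Outside the range, either m = 0, where the component is the counit of an element of its kernel,
   or m > N. *)
move: mN; rewrite mem_index_iota ltnS negb_and -leqNgt leqn0 -ltnNge.
case/orP=> [/eqP ->|/aN //].
by have /eqP := aug_valP a.
Qed.

End Stuffle_map.

End Augmentation.

Theorem theorem1 (k : fieldType) (H : bialgebra k) (hH : connected H) :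
  exists iota : {linear H -> stuffle (aug_alg H)},
    [/\ is_stuffle_map iota,
        (forall j : {linear H -> stuffle (aug_alg H)}, is_stuffle_map j -> j =1 iota),
        injective iota,
        (iota 1 = st_one (aug_alg H) /\
         forall x y : H, iota (x * y) = st_mul (iota x) (iota y)) &
        (forall h : H, st_counit (iota h) = counit h) /\
        (forall h : H, st_coprod (iota h) = tmap iota iota (coprod h))].
Proof.
pose lin := GRing.isLinear.Build _ _ _ _ (st_map hH) (st_map_linear hH).
pose iota : {linear H -> stuffle (aug_alg H)} := HB.pack (st_map hH) lin.
exists iota; split.
- split=> [|a]; first exact: st_map1.
  have [N aN] := red_iter_fin hH (aug_val a).
  have aN' n : (N < n)%N -> red_coprod n a = 0 by move/ltnW/aN.
  by exists N; split; last exact: st_map_aug.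
- move=> j [j1 ja] h.
  (* Uniqueness: on [H'] the bound supplied by [j] also serves to evaluate iota, so both give the
     same finite sum. *)
  have -> : h = (counit h : k) *: 1 + aug_val (aug_proj h) by rewrite /= addrC subrK.
  have [N [aN jN]] := ja (aug_proj h).
  by rewrite !linearP j1 jN -(st_map_aug hH aN) [iota 1]st_map1.
- exact: st_map_inj.
- by split; [exact: st_map1|exact: st_map_mul].
(* The counit identity holds by computation on the component of length 0. *)
- by split; [|exact: st_coprod_map].
Qed.
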